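(* Let $\alpha,\beta\in\mathbb{R}$. The double inequality $$\alpha A(a,b)+(1-\alpha)G(a,b)<P(a,b)<\beta A(a,b)+(1-\beta)G(a,b)$$ holds for all real $a,b>0$ with $a\ne b$ if and only if $\alpha\le \frac{2}{\pi}$ and $\beta\ge \frac{2}{3}$.
   Context: For real numbers $a,b>0$ with $a\neq b$: the arithmetic mean is $A(a,b)=\frac{a+b}{2}$; the geometric mean is $G(a,b)=\sqrt{ab}$; the first Seiffert mean is $P(a,b)=\frac{a-b}{4\arctan\sqrt{a/b}-\pi}$, equivalently $P(a,b)=\frac{a-b}{2\arcsin\left(\frac{a-b}{a+b}\right)}$. *)

(* Defs.v *)
From Stdlib Require Import Reals.
Local Open Scope R_scope.

Definition arith_mean (a b : R) : R := (a + b) / 2.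

Definition geom_mean (a b : R) : R := sqrt (a * b).

(* For a, b > 0 the denominator vanishes only when a = b; this function is used
   only for distinct positive a and b. *)
Definition seiffert_mean (a b : R) : R :=
  (a - b) / (4 * atan (sqrt (a / b)) - PI).

(* Main.v *)
Require Import Defs.
From Stdlib Require Import Reals Lra.
From Coquelicot Require Import Coquelicot.
Local Open Scope R_scope.

(** Put [a = M (1 + sin t)] and [b = M (1 - sin t)] with [0 < t < PI / 2]; every
    pair [0 < b < a] arises so, and the three means are symmetric.  Then
    [A = M], [G = M cos t] and [P = M sin t / t], and the position of [P] between
    [G] and [A] is measured by
    [(P - G) / (A - G) = (sin t - t cos t) / (t (1 - cos t))],
    called [seiffert_position] below.  So the theorem says that the infimum and
    the supremum of this function on [(0, PI / 2)] are [2 / PI] and [2 / 3], and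
    that neither is attained.

    The function is strictly decreasing on [(0, PI / 2]]
    ([seiffert_position_decr]) by the monotone form of l'Hopital's rule
    ([monotone_lhopital]) applied three times: differentiating numerator and
    denominator twice leads to
    [(sin t + t cos t) / (2 sin t + t cos t)], a monotone function of
    [t / tan t], and [t / tan t] decreases since the quotient of the derivatives
    is [cos t ^ 2].  Hence the infimum is the value [2 / PI] at [PI / 2], not
    attained inside; by continuity no larger constant is a lower bound.  At [0],
    Taylor bounds give [2 / 3 - t ^ 2 / 12 <= seiffert_position t < 2 / 3],
    which settles the supremum. *)

(** * A monotone form of l'Hopital's rule *)

(** With [c = f b / g b], the function [f - c g] vanishes at [a] and at [b].  If
    it were nonpositive at [x], the mean value theorem would give a point left of
    [x] with [df <= c dg] and one right of [x] with [df >= c dg], against the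
    strict decrease of [df / dg]. *)
Lemma monotone_lhopital (f g df dg : R -> R) (a b x : R) :
  a < x < b ->
  (forall t, a <= t <= b -> is_derive f t (df t)) ->
  (forall t, a <= t <= b -> is_derive g t (dg t)) ->
  f a = 0 -> g a = 0 ->
  (forall t, a < t < b -> 0 < dg t) ->
  (forall s t, a < s -> s < t -> t < b -> df t / dg t < df s / dg s) ->
  f b / g b < f x / g x.
Proof.
intros [hax hxb] hf hg fa ga dg0 hr.
assert (gpos : forall y, a < y <= b -> 0 < g y).
{ intros y hy.
  destruct (MVT_cor2 g dg a y) as [c [e hc]]; try lra.
  { intros t ht; apply is_derive_Reals, hg; lra. }
  rewrite ga in e.
  assert (0 < dg c) by (apply dg0; lra).
  assert (0 < dg c * (y - a)) by (apply Rmult_lt_0_compat; lra).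
  lra. }
assert (gx := gpos x ltac:(lra)); assert (gb := gpos b ltac:(lra)).
set (c := f b / g b).
assert (fb : f b = c * g b) by (unfold c; field; lra).
assert (dK : forall t, a <= t <= b ->
  derivable_pt_lim (fun t => f t - c * g t) t (df t - c * dg t)).
{ intros t ht; apply is_derive_Reals.
  apply (is_derive_minus f (fun t => c * g t)); [now apply hf|].
  apply (is_derive_scal g); now apply hg. }
destruct (Rlt_or_le (c * g x) (f x)) as [h|h].
{ apply (Rmult_lt_reg_r (g x)); [assumption|].
  replace (f x / g x * g x) with (f x) by (field; lra); exact h. }
exfalso.
destruct (MVT_cor2 (fun t => f t - c * g t) (fun t => df t - c * dg t) a x)
  as [s [es hs]]; [lra|intros; apply dK; lra|].
destruct (MVT_cor2 (fun t => f t - c * g t) (fun t => df t - c * dg t) x b)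
  as [t [et ht]]; [lra|intros; apply dK; lra|].
assert (ds := dg0 s ltac:(lra)); assert (dt := dg0 t ltac:(lra)).
assert (df s <= c * dg s) by nra.
assert (c * dg t <= df t) by nra.
assert (df s / dg s <= c).
{ apply (Rmult_le_reg_r (dg s)); [assumption|].
  replace (df s / dg s * dg s) with (df s) by (field; lra); assumption. }
assert (c <= df t / dg t).
{ apply (Rmult_le_reg_r (dg t)); [assumption|].
  replace (df t / dg t * dg t) with (df t) by (field; lra); assumption. }
assert (hst := hr s t ltac:(lra) ltac:(lra) ltac:(lra)).
lra.
Qed.

(** * The relative position of the Seiffert mean *)

Definition seiffert_position (t : R) : R :=
  (sin t - t * cos t) / (t * (1 - cos t)).

Lemma sin_cos_acute (t : R) : 0 < t < PI / 2 ->
  0 < sin t < 1 /\ 0 < cos t < 1.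
Proof.
intros ht.
assert (0 < sin t) by (apply sin_gt_0; lra).
assert (0 < cos t) by (apply cos_gt_0; lra).
assert (e := sin2_cos2 t); unfold Rsqr in e.
split; split; nra.
Qed.

(** On [[0, PI / 2)], [id' / tan' = cos ^ 2], which decreases. *)
Lemma id_div_tan_decr (x y : R) : 0 < x -> x < y -> y < PI / 2 ->
  y / tan y < x / tan x.
Proof.
intros hx hxy hy.
apply (monotone_lhopital (fun t => t) tan (fun _ => 1)
         (fun t => (tan t)^2 + 1) 0 y x); try lra.
- intros t ht; auto_derive; auto.
- intros t ht; apply is_derive_tan.
  apply Rgt_not_eq, cos_gt_0; lra.
- apply tan_0.
- intros; nra.
- intros s t h0 hst hty.
  assert (0 < tan s) by (apply tan_gt_0; lra).
  assert (tan s < tan t) by (apply tan_increasing; lra).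
  unfold Rdiv; rewrite !Rmult_1_l.
  apply Rinv_lt_contravar; nra.
Qed.

(** The quotient is [1 - 1 / (2 + t / tan t)]. *)
Lemma second_derivative_quotient_decr (x y : R) :
  0 < x -> x < y -> y < PI / 2 ->
  (sin y + y * cos y) / (2 * sin y + y * cos y) <
  (sin x + x * cos x) / (2 * sin x + x * cos x).
Proof.
intros hx hxy hy.
assert (e : forall t, 0 < t < PI / 2 -> 0 < t / tan t /\
  (sin t + t * cos t) / (2 * sin t + t * cos t) = 1 - / (2 + t / tan t)).
{ intros t ht.
  destruct (sin_cos_acute t ht) as [[hs _] [hc _]].
  assert (0 < t * cos t) by (apply Rmult_lt_0_compat; lra).
  split.
  - apply Rdiv_lt_0_compat; [lra|apply tan_gt_0; lra].
  - unfold tan; field; repeat split; lra. }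
destruct (e x) as [px ->]; [lra|]; destruct (e y) as [py ->]; [lra|].
assert (q := id_div_tan_decr x y hx hxy hy).
assert (/ (2 + x / tan x) < / (2 + y / tan y)); [|lra].
apply Rinv_lt_contravar; [apply Rmult_lt_0_compat|]; lra.
Qed.

Lemma first_derivative_quotient_decr (x y : R) :
  0 < x -> x < y -> y < PI / 2 ->
  (y * sin y) / (1 - cos y + y * sin y) <
  (x * sin x) / (1 - cos x + x * sin x).
Proof.
intros hx hxy hy.
apply (monotone_lhopital (fun t => t * sin t)
         (fun t => 1 - cos t + t * sin t)
         (fun t => sin t + t * cos t)
         (fun t => 2 * sin t + t * cos t) 0 y x); try lra.
- intros t _; auto_derive; [auto|ring].
- intros t _; auto_derive; [auto|ring].
- rewrite cos_0; ring.
- intros t ht; destruct (sin_cos_acute t ltac:(lra)) as [[hs _] [hc _]]; nra.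
- intros s t h0 hst hty; apply second_derivative_quotient_decr; lra.
Qed.

Lemma seiffert_position_decr (x y : R) : 0 < x -> x < y -> y <= PI / 2 ->
  seiffert_position y < seiffert_position x.
Proof.
intros hx hxy hy.
apply (monotone_lhopital (fun t => sin t - t * cos t)
         (fun t => t * (1 - cos t)) (fun t => t * sin t)
         (fun t => 1 - cos t + t * sin t) 0 y x); try lra.
- intros t _; auto_derive; [auto|ring].
- intros t _; auto_derive; [auto|ring].
- rewrite sin_0; ring.
- intros t ht; destruct (sin_cos_acute t ltac:(lra)) as [[hs _] [_ hc]].
  assert (0 < t * sin t) by (apply Rmult_lt_0_compat; lra); lra.
- intros s t h0 hst hty; apply first_derivative_quotient_decr; lra.
Qed.

Lemma seiffert_position_PI2 : seiffert_position (PI / 2) = 2 / PI.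
Proof.
unfold seiffert_position; rewrite sin_PI2, cos_PI2.
assert (h := PI_RGT_0); field; lra.
Qed.

Lemma seiffert_position_denom_pos (t : R) : 0 < t < PI / 2 ->
  0 < t * (1 - cos t).
Proof.
intros ht; destruct (sin_cos_acute t ht) as [_ hc].
apply Rmult_lt_0_compat; lra.
Qed.

Lemma sin_taylor_bounds (t : R) : 0 <= t <= PI ->
  t - t^3 / 6 <= sin t <= t - t^3 / 6 + t^5 / 120.
Proof.
intros ht.
destruct (sin_bound t 0 ltac:(lra) ltac:(lra)) as [l u].
unfold sin_approx, sin_term in l, u; simpl in l, u.
split; [apply Rle_trans with (2 := l)|apply Rle_trans with (1 := u)];
  right; field.
Qed.

Lemma cos_taylor_bounds (t : R) : - PI / 2 <= t <= PI / 2 ->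
  1 - t^2 / 2 <= cos t <= 1 - t^2 / 2 + t^4 / 24 /\
  1 - t^2 / 2 + t^4 / 24 - t^6 / 720 <= cos t.
Proof.
intros ht.
destruct (cos_bound t 0 ltac:(lra) ltac:(lra)) as [l u].
destruct (cos_bound t 1 ltac:(lra) ltac:(lra)) as [l' _].
unfold cos_approx, cos_term in l, u, l'; simpl in l, u, l'.
repeat split;
  [apply Rle_trans with (2 := l)|apply Rle_trans with (1 := u)
  |apply Rle_trans with (2 := l')]; right; field.
Qed.

(** The Taylor bounds give
    [3 sin t - t (2 + cos t) <= - t ^ 5 / 60 + t ^ 7 / 720], which is negative
    as long as [t ^ 2 < 12]. *)
Lemma seiffert_position_lt (t : R) : 0 < t < PI / 2 ->
  seiffert_position t < 2 / 3.
Proof.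
intros ht.
assert (hD := seiffert_position_denom_pos t ht).
assert (h4 := PI_4).
destruct (sin_taylor_bounds t) as [_ hs]; [lra|].
destruct (cos_taylor_bounds t) as [_ hc]; [lra|].
apply (Rmult_lt_reg_r (t * (1 - cos t))); [assumption|].
unfold seiffert_position, Rdiv at 1.
rewrite Rmult_assoc, Rinv_l, Rmult_1_r by lra.
assert (ct : t * (1 - t^2 / 2 + t^4 / 24 - t^6 / 720) <= t * cos t)
  by (apply Rmult_le_compat_l; lra).
assert (p5 : 0 < t^5) by (apply pow_lt; lra).
assert (p7 : 0 < t^5 * (12 - t^2)) by (apply Rmult_lt_0_compat; nra).
nra.
Qed.

(** The numerator is at least [t ^ 3 / 3 - t ^ 5 / 24] and the denominator at
    most [t ^ 3 / 2]. *)
Lemma seiffert_position_ge (t : R) : 0 < t < PI / 2 ->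
  2 / 3 - t^2 / 12 <= seiffert_position t.
Proof.
intros ht.
assert (hD := seiffert_position_denom_pos t ht).
assert (h4 := PI_4).
destruct (sin_taylor_bounds t) as [hs _]; [lra|].
destruct (cos_taylor_bounds t) as [[hc hc'] _]; [lra|].
apply (Rmult_le_reg_r (t * (1 - cos t))); [assumption|].
unfold seiffert_position, Rdiv at 3.
rewrite Rmult_assoc, Rinv_l, Rmult_1_r by lra.
assert (t * cos t <= t * (1 - t^2 / 2 + t^4 / 24))
  by (apply Rmult_le_compat_l; lra).
assert (t * (1 - cos t) <= t * (t^2 / 2))
  by (apply Rmult_le_compat_l; lra).
assert ((2 / 3 - t^2 / 12) * (t * (1 - cos t))
        <= (2 / 3 - t^2 / 12) * (t * (t^2 / 2)))
  by (apply Rmult_le_compat_l; nra).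
nra.
Qed.

Lemma lower_bounds_seiffert_position (alpha : R) :
  (forall t, 0 < t < PI / 2 -> alpha < seiffert_position t) <->
  alpha <= 2 / PI.
Proof.
assert (hpi := PI_RGT_0).
split; intros h.
- destruct (Rle_or_lt alpha (2 / PI)) as [|hlt]; [assumption|exfalso].
  rewrite <- seiffert_position_PI2 in hlt.
  assert (hcont : continuous seiffert_position (PI / 2)).
  { apply (ex_derive_continuous (K := R_AbsRing) (V := R_NormedModule)).
    unfold seiffert_position; auto_derive; rewrite cos_PI2; lra. }
  destruct (hcont _ (open_lt alpha _ hlt)) as [d hd].
  (* a point of (0, PI / 2) within d of PI / 2 *)
  set (t := Rmax (PI / 4) (PI / 2 - d / 2)).
  assert (hd0 := cond_pos d).
  assert (t1 : PI / 4 <= t) by apply Rmax_l.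
  assert (t2 : PI / 2 - d / 2 <= t) by apply Rmax_r.
  assert (t3 : t < PI / 2) by (apply Rmax_lub_lt; lra).
  assert (ht : seiffert_position t < alpha).
  { apply hd; apply Rabs_lt_between'; lra. }
  assert (h' := h t ltac:(lra)); lra.
- intros t ht; rewrite <- seiffert_position_PI2 in h.
  apply Rle_lt_trans with (1 := h), seiffert_position_decr; lra.
Qed.

Lemma upper_bounds_seiffert_position (beta : R) :
  (forall t, 0 < t < PI / 2 -> seiffert_position t < beta) <->
  2 / 3 <= beta.
Proof.
assert (h2 := PI2_1).
split; intros h.
- destruct (Rle_or_lt (2 / 3) beta) as [|hlt]; [assumption|exfalso].
  (* since t <= 1, the error t ^ 2 / 12 of the lower bound is below the gap
     2 / 3 - beta *)
  set (t := Rmin 1 (2 / 3 - beta)).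
  assert (t0 : 0 < t) by (apply Rmin_glb_lt; lra).
  assert (t1 : t <= 1) by apply Rmin_l.
  assert (t2 : t <= 2 / 3 - beta) by apply Rmin_r.
  assert (ht : 0 < t < PI / 2) by lra.
  assert (hl := seiffert_position_ge t ht).
  assert (hu := h t ht); nra.
- intros t ht; apply Rlt_le_trans with (2 := h).
  now apply seiffert_position_lt.
Qed.

(** * Trigonometric form of the means *)

(** With [s = sqrt (a / b)], the double-angle formula gives
    [sin (2 atan s - PI / 2) = (s ^ 2 - 1) / (s ^ 2 + 1)], which is
    [(a - b) / (a + b)]; and [2 atan s - PI / 2] lies in the range of [asin]. *)
Lemma seiffert_mean_asin (a b : R) : 0 < a -> 0 < b ->
  seiffert_mean a b = (a - b) / (2 * asin ((a - b) / (a + b))).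
Proof.
intros ha hb.
assert (hab : 0 < a / b) by (apply Rdiv_lt_0_compat; lra).
set (s := sqrt (a / b)).
assert (hs : 0 < s) by (apply sqrt_lt_R0; lra).
assert (hs2 : s * s = a / b) by (apply sqrt_sqrt; lra).
assert (hat : 0 < atan s < PI / 2).
{ split; [rewrite <- atan_0; now apply atan_increasing|].
  apply atan_bound. }
assert (e : sin (2 * atan s - PI / 2) = (a - b) / (a + b)).
{ replace (2 * atan s - PI / 2) with (- (PI / 2 - 2 * atan s)) by ring.
  rewrite sin_neg, sin_shift, cos_2a, sin_atan, cos_atan.
  set (r := sqrt (1 + s²)).
  assert (hr : r * r = 1 + a / b).
  { unfold r; rewrite sqrt_sqrt; unfold Rsqr; rewrite hs2; lra. }
  assert (r0 : r <> 0) by (intros r0; rewrite r0 in hr; lra).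
  replace (1 / r * (1 / r) - s / r * (s / r))
    with ((1 - s * s) / (r * r)) by (field; assumption).
  rewrite hr, hs2; field; split; lra. }
unfold seiffert_mean; fold s.
rewrite <- e, asin_sin by lra.
f_equal; field.
Qed.

Lemma seiffert_mean_sym (a b : R) : 0 < a -> 0 < b ->
  seiffert_mean a b = seiffert_mean b a.
Proof.
intros ha hb; rewrite !seiffert_mean_asin by assumption.
replace ((b - a) / (b + a)) with (- ((a - b) / (a + b))) by (field; lra).
rewrite asin_opp.
replace (b - a) with (- (a - b)) by ring.
replace (2 * - asin ((a - b) / (a + b)))
  with (- (2 * asin ((a - b) / (a + b)))) by ring.
unfold Rdiv; rewrite Rinv_opp; ring.
Qed.

Lemma means_trig (M t : R) : 0 < M -> 0 < t < PI / 2 ->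
  arith_mean (M * (1 + sin t)) (M * (1 - sin t)) = M /\
  geom_mean (M * (1 + sin t)) (M * (1 - sin t)) = M * cos t /\
  seiffert_mean (M * (1 + sin t)) (M * (1 - sin t)) = M * (sin t / t).
Proof.
intros hM ht; destruct (sin_cos_acute t ht) as [hs hc].
split; [|split].
- unfold arith_mean; field.
- unfold geom_mean.
  assert (e := sin2_cos2 t); unfold Rsqr in e.
  replace (M * (1 + sin t) * (M * (1 - sin t)))
    with ((M * cos t) * (M * cos t)) by nra.
  apply sqrt_square, Rmult_le_pos; lra.
- rewrite seiffert_mean_asin by (apply Rmult_lt_0_compat; lra).
  replace ((M * (1 + sin t) - M * (1 - sin t)) /
           (M * (1 + sin t) + M * (1 - sin t))) with (sin t) by (field; lra).
  rewrite asin_sin by lra; field; lra.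
Qed.

Lemma ordered_pair_trig (a b : R) : 0 < b -> b < a ->
  exists M t, 0 < M /\ 0 < t < PI / 2 /\
    a = M * (1 + sin t) /\ b = M * (1 - sin t).
Proof.
intros hb hab.
set (x := (a - b) / (a + b)).
assert (x0 : 0 < x) by (apply Rdiv_lt_0_compat; lra).
assert (x1 : x < 1).
{ apply (Rmult_lt_reg_r (a + b)); [lra|].
  unfold x; replace ((a - b) / (a + b) * (a + b)) with (a - b) by (field; lra).
  lra. }
exists ((a + b) / 2), (asin x); rewrite sin_asin by lra.
assert (hb' := asin_bound_lt x ltac:(lra)).
repeat split; try lra; try (unfold x; field; lra).
apply sin_increasing_0; try lra.
rewrite sin_0, sin_asin; lra.
Qed.

(** * The sharp constants *)

Lemma lower_mix_iff (alpha M t : R) : 0 < M -> 0 < t < PI / 2 ->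
  alpha * M + (1 - alpha) * (M * cos t) < M * (sin t / t) <->
  alpha < seiffert_position t.
Proof.
intros hM ht.
assert (hD := seiffert_position_denom_pos t ht).
destruct (sin_cos_acute t ht) as [_ hc].
replace (M * (sin t / t)) with
  (M * cos t + M * (1 - cos t) * seiffert_position t)
  by (unfold seiffert_position; field; split; lra).
assert (0 < M * (1 - cos t)) by (apply Rmult_lt_0_compat; lra).
split; intros h; nra.
Qed.

Lemma upper_mix_iff (beta M t : R) : 0 < M -> 0 < t < PI / 2 ->
  M * (sin t / t) < beta * M + (1 - beta) * (M * cos t) <->
  seiffert_position t < beta.
Proof.
intros hM ht.
assert (hD := seiffert_position_denom_pos t ht).
destruct (sin_cos_acute t ht) as [_ hc].
replace (M * (sin t / t)) with
  (M * cos t + M * (1 - cos t) * seiffert_position t)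
  by (unfold seiffert_position; field; split; lra).
assert (0 < M * (1 - cos t)) by (apply Rmult_lt_0_compat; lra).
split; intros h; nra.
Qed.

(** Both directions are the substitution [a = M (1 + sin t)],
    [b = M (1 - sin t)]: with [M = 1] to reach every [t], and for [a < b] after
    exchanging the arguments. *)
Lemma double_inequality_iff_position (alpha beta : R) :
  (forall a b : R, 0 < a -> 0 < b -> a <> b ->
     alpha * arith_mean a b + (1 - alpha) * geom_mean a b < seiffert_mean a b /\
     seiffert_mean a b < beta * arith_mean a b + (1 - beta) * geom_mean a b)
  <-> (forall t, 0 < t < PI / 2 -> alpha < seiffert_position t < beta).
Proof.
split.
- intros h t ht; destruct (sin_cos_acute t ht) as [hs _].
  destruct (h (1 * (1 + sin t)) (1 * (1 - sin t))) as [hl hu]; try lra.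
  destruct (means_trig 1 t) as [eA [eG eP]]; [lra|assumption|].
  rewrite eA, eG, eP in hl, hu.
  split; [apply (lower_mix_iff alpha 1 t)|apply (upper_mix_iff beta 1 t)];
    auto; lra.
- intros h.
  assert (ord : forall a b, 0 < b -> b < a ->
     alpha * arith_mean a b + (1 - alpha) * geom_mean a b < seiffert_mean a b /\
     seiffert_mean a b < beta * arith_mean a b + (1 - beta) * geom_mean a b).
  { intros a b hb hab.
    destruct (ordered_pair_trig a b hb hab) as [M [t [hM [ht [-> ->]]]]].
    destruct (means_trig M t hM ht) as [-> [-> ->]].
    destruct (h t ht).
    split; [apply lower_mix_iff|apply upper_mix_iff]; assumption. }
  intros a b ha hb hne.
  destruct (Rtotal_order a b) as [hlt|[heq|hgt]]; [|contradiction|auto].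
  rewrite seiffert_mean_sym by assumption.
  unfold arith_mean, geom_mean; rewrite (Rplus_comm a b), (Rmult_comm a b).
  now apply ord.
Qed.

Theorem theorem5p3 (alpha beta : R) :
  (forall a b : R, 0 < a -> 0 < b -> a <> b ->
     alpha * arith_mean a b + (1 - alpha) * geom_mean a b < seiffert_mean a b /\
     seiffert_mean a b < beta * arith_mean a b + (1 - beta) * geom_mean a b)
  <-> (alpha <= 2 / PI /\ beta >= 2 / 3).
Proof.
rewrite double_inequality_iff_position.
split.
- intros h; split.
  + apply lower_bounds_seiffert_position; intros t ht; now apply h.
  + apply Rle_ge, upper_bounds_seiffert_position; intros t ht; now apply h.
- intros [hal hbe] t ht; split.
  + now apply lower_bounds_seiffert_position.
  + now apply upper_bounds_seiffert_position; [apply Rge_le|].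
Qed.
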